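(* Let $\mu$ be a probability measure on a space $X$ and let $a \le b$ be real constants. If $f: X \rightarrow [a,b]$ is a measurable function and $\varphi:[a,b]\to\mathbb{R}$ is a convex function on $[a,b]$ (not assumed continuous), then $f$ and $\varphi \circ f$ are $\mu$-integrable functions and $$ \varphi \Big( a+b - \int _{X} f\,d\mu \Big) \le \varphi(a) + \varphi(b) - \int _{X}\varphi \circ f\,d\mu . $$ *)

(* Defs.v *)
From mathcomp Require Export all_boot all_order all_algebra.
From mathcomp Require Export all_classical all_reals all_analysis.
Export Order.TTheory GRing.Theory Num.Theory.
Export numFieldNormedType.Exports.

(* Main.v *)
Require Import Defs.
From mathcomp Require Import measurable_realfun ring lra.

Set Implicit Arguments.
Unset Strict Implicit.
Unset Printing Implicit Defensive.

Local Open Scope classical_set_scope.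
Local Open Scope ring_scope.

(** With [g] the affine interpolant of [phi] at the endpoints, [phi <= g] on
    [[a, b]], so integrating gives [\int phi \o f <= g (\int f)]. As [g] is
    affine, [g (a + b - t) = phi a + phi b - g t], hence
    [phi (a + b - \int f) <= g (a + b - \int f) = phi a + phi b - g (\int f)].
    No supporting line, hence no continuity of [phi], is needed. *)

Lemma convex_function_le (R : realType) (D : set R) (phi : R -> R)
    (x y t : R) : convex_function D phi -> D x -> D y -> 0 <= t <= 1 ->
  phi (t * x + (1 - t) * y) <= t * phi x + (1 - t) * phi y.
Proof.
move=> cphi Dx Dy /andP[t0 t1].
exact: (cphi (Itv01 t0 t1) x y (mem_set Dx) (mem_set Dy)).
Qed.

Lemma itvcc_convex_comb (R : realType) (x y z : R) : x <= z <= y ->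
  exists2 t, 0 <= t <= 1 & z = t * x + (1 - t) * y.
Proof.
move=> /andP[xz zy]; have [xy|yx] := ltP x y; last first.
  (* Here [y <= x] forces [x = z = y], so any weight would do. *)
  by exists 0; [rewrite lexx ler01 | lra].
exists ((y - z) / (y - x)).
  by rewrite divr_ge0 ?ler_pdivrMr ?subr_ge0 ?subr_gt0 ?(ltW xy)// mul1r; lra.
by field; lra.
Qed.

(* The sublevel sets of a convex function on an interval are intervals. *)
Lemma convex_function_measurable (R : realType) (D : set R) (phi : R -> R) :
  is_interval D -> convex_function D phi -> measurable_fun D phi.
Proof.
move=> itvD cphi mD.
(* The open rays below [c] generate the Borel sets, so strict sublevel sets suffice. *)
apply: (measurability _ (RGenInftyO.measurableE R)) => // _ [_ [c ->] <-].
apply: is_interval_measurable => x y [Dx xc] [Dy yc] z xzy.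
split; first exact: (itvD x y).
have [t t01 ->] := itvcc_convex_comb xzy.
have := convex_function_le cphi Dx Dy t01.
move: xc yc t01; rewrite /= !in_itv/= => xc yc t01 phile.
have [m [xm ym mc]] : exists m, [/\ phi x <= m, phi y <= m & m < c].
  by exists (Num.max (phi x) (phi y)); split;
    rewrite ?le_max ?gt_max ?lexx ?orbT ?xc.
by rewrite (le_lt_trans phile)// (le_lt_trans _ mc)//; nra.
Qed.

Section convex_on_itv.
Context {R : realType} {a b : R} {phi : R -> R}.
Hypotheses (ab : a <= b)
  (cphi : convex_function (`[a, b]%classic : set R) phi).

Let itva : `[a, b]%classic a. Proof. by rewrite /= in_itv/= lexx. Qed.
Let itvb : `[a, b]%classic b. Proof. by rewrite /= in_itv/= lexx andbT. Qed.

(* When [a = b] the quotient is [0] and the bound reads [phi y <= phi a]. *)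
Lemma convex_function_le_chord (y : R) : y \in `[a, b] ->
  phi y <= phi a + (phi b - phi a) / (b - a) * (y - a).
Proof.
rewrite in_itv/= => /itvcc_convex_comb[t t01 ->].
apply: le_trans (convex_function_le cphi itva itvb t01) _.
have [<-|ba] := eqVneq a b; first lra.
(* For [a != b] the weighted mean of the endpoint values is exactly the chord at that point. *)
rewrite le_eqVlt; apply/orP; left; apply/eqP.
by field; rewrite subr_eq0 eq_sym.
Qed.

(* Bounded below because the value at the midpoint is at most the mean of the
   values at [y] and at its reflection [a + b - y]. *)
Lemma convex_function_bounded :
  exists M, forall y, y \in `[a, b] -> `|phi y| <= M.
Proof.
pose m := (a + b) / 2.
(* The first two terms bound [phi] from above at [y] and at its reflection; the lower bound is then
   [2 * phi m] minus the value at the reflection. *)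
exists (`|phi a| + `|phi b| + 2 * `|phi m|) => y.
rewrite in_itv/= => yab.
have /itvcc_convex_comb[t t01 ye] := yab.
have phiy := convex_function_le cphi itva itvb t01; rewrite -ye in phiy.
have phiy' := convex_function_le cphi itvb itva t01.
have Dy : `[a, b]%classic y by rewrite /= in_itv.
(* Swapping the weights of [y] gives its reflection [a + b - y]. *)
have Dy' : `[a, b]%classic (t * b + (1 - t) * a).
  by rewrite /= in_itv/=; apply/andP; split; lra.
have half01 : 0 <= (2^-1 : R) <= 1 by lra.
have := convex_function_le cphi Dy Dy' half01.
have -> : 2^-1 * y + (1 - 2^-1) * (t * b + (1 - t) * a) = m by rewrite /m; lra.
move=> phim.
have := ler_norm (phi a); have := ler_norm (phi b).
have := ler_norm (- phi m); rewrite normrN => nm nb na.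
have := normr_ge0 (phi a); have := normr_ge0 (phi b).
have := normr_ge0 (phi m) => m0 b0 a0.
rewrite ler_norml; apply/andP; split; nra.
Qed.

End convex_on_itv.

Lemma bounded_integrable (R : realType) (d : measure_display)
    (X : measurableType d) (mu : {finite_measure set X -> \bar R}) (g : X -> R)
    (M : R) :
  measurable_fun [set: X] g -> (forall x, `|g x| <= M) ->
  mu.-integrable [set: X] (EFin \o g).
Proof.
move=> mg gM; apply: measurable_bounded_integrable => //.
  by rewrite ltey_eq fin_num_measure.
exists M; split; first exact: num_real.
by move=> N MN x _ /=; rewrite (le_trans (gM x))// ltW.
Qed.

Theorem theorem15 (R : realType) (d : measure_display) (X : measurableType d)
    (mu : probability X R) (a b : R) (hab : a <= b)
    (f : X -> R) (f_range : forall x : X, f x \in `[a, b])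
    (f_meas : measurable_fun [set: X] f)
    (phi : R -> R) (phi_convex : convex_function (`[a, b]%classic : set R) phi) :
  [/\ mu.-integrable [set: X] (EFin \o f),
      mu.-integrable [set: X] (EFin \o (phi \o f)) &
      phi (a + b - \int[mu]_x f x)
        <= phi a + phi b - \int[mu]_x (phi \o f) x].
Proof.
have f_int : mu.-integrable [set: X] (EFin \o f).
  apply: (@bounded_integrable _ _ _ _ _ (`|a| + `|b|)) => // x.
  have := f_range x; rewrite in_itv/= => /andP[afx fxb].
  have := ler_norm b; have := ler_norm (- a); rewrite normrN => na nb.
  have a0 := normr_ge0 a; have b0 := normr_ge0 b.
  by rewrite ler_norml; apply/andP; split; lra.
have phif_int : mu.-integrable [set: X] (EFin \o (phi \o f)).
  have [M phiM] := convex_function_bounded hab phi_convex.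
  apply: (@bounded_integrable _ _ _ _ _ M) => [|x]; last exact: phiM.
  (* [phi] is controlled only on the interval, so the composition passes through that set, which
     contains the range of [f]. *)
  apply: (@measurable_comp _ _ _ _ _ _ `[a, b]%classic) => //.
  - by move=> _ [x _ <-]; exact: f_range.
  - by apply: convex_function_measurable => //; exact: interval_is_interval.
split=> //.
have int_cst c : \int[mu]_x c = c.
  by rewrite Rintegral_cst//= probability_setT/= mulr1.
have cst_int c : mu.-integrable [set: X] (EFin \o cst c).
  exact: finite_measure_integrable_cst.
set F := \int[mu]_x f x.
(* Total mass 1 makes the mean [F] lie in the interval, hence also its reflection [a + b - F], where
   the chord bound is applied. *)
have aF : a <= F.
  rewrite -(int_cst a); apply: le_Rintegral => //; first exact: cst_int.
  by move=> x _; have := f_range x; rewrite in_itv/= => /andP[].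
have Fb : F <= b.
  rewrite -(int_cst b); apply: le_Rintegral => //; first exact: cst_int.
  by move=> x _; have := f_range x; rewrite in_itv/= => /andP[].
have abF : a + b - F \in `[a, b] by rewrite in_itv/=; apply/andP; split; lra.
have phi_abF := convex_function_le_chord hab phi_convex abF.
set q := (phi b - phi a) / (b - a) in phi_abF.
have qf_int : mu.-integrable [set: X] (EFin \o (fun x => q * f x)).
  by apply: eq_integrable (integrableZl _ q f_int) => //.
(* The right side is the chord at [F], split into intercept and slope so that the integral acts by
   linearity. *)
have phif_le : \int[mu]_x (phi \o f) x <= (phi a - q * a) + q * F.
  rewrite -(int_cst (phi a - q * a)) -RintegralZl// -RintegralD//;
    last exact: cst_int.
  apply: le_Rintegral => //.
    by apply: eq_integrable (integrableD _ (cst_int (phi a - q * a)) qf_int).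
  move=> x _ /=.
  have := convex_function_le_chord hab phi_convex (f_range x).
  by rewrite -/q; lra.
(* This says that the chord takes the value [phi b] at [b]; if [a = b], both sides vanish. It links
   the chord at [F] to the chord at [a + b - F]. *)
have qE : q * (b - a) = phi b - phi a.
  rewrite /q; have [->|ba] := eqVneq a b; first by rewrite !subrr mulr0.
  by rewrite divfK// subr_eq0 eq_sym.
lra.
Qed.
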